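(* Let $n,p\ge 1$, let $f_1,\dots,f_n:\mathbb{R}^p\to\mathbb{R}$ and mixing matrices $W,\tilde W\in\mathbb{R}^{n\times n}$ satisfy Assumptions 1, 2 and 3 listed in the context, and let $L_{\mathbf f}=\max_i L_{f_i}$. Let $\alpha>0$, let $x^*$ be an optimal solution of $\min_x \bar f(x)$, $\mathbf{x}^*=\mathbf{1}(x^* )^{\mathrm T}$, and let $\mathbf{q}^*\in\mathbb{R}^{n\times p}$ be of the form $\mathbf{q}^*=U\mathbf{p}$ for some $\mathbf{p}\in\mathbb{R}^{n\times p}$ and satisfy $U\mathbf{q}^*+\alpha\nabla\mathbf{f}(\mathbf{x}^* )=\mathbf{0}$; put $\mathbf{z}^*=\begin{pmatrix}\mathbf{q}^*\\ \mathbf{x}^*\end{pmatrix}$. Suppose that the function $$\mathbf{g}(\mathbf{x})=\mathbf{f}(\mathbf{x})+\frac{1}{4\alpha}\|\mathbf{x}\|_{\tilde W-W}^2$$ is restricted strongly convex with respect to $\mathbf{x}^*$ with constant $\mu_{\mathbf g}>0$, and that the step size satisfies $$\alpha<\frac{2\mu_{\mathbf g}\lambda_{\min}(\tilde W)}{L_{\mathbf f}^2}.$$ Then there exists $\delta>0$ such that the sequence $\{\mathbf{z}^k\}$ generated by EXTRA with step size $\alpha$ (from an arbitrary starting point $\mathbf{x}^0\in\mathbb{R}^{n\times p}$) satisfies, for all $k=0,1,\dots$, $$\|\mathbf{z}^k-\mathbf{z}^*\|_G^2\ \ge\ (1+\delta)\,\|\mathbf{z}^{k+1}-\mathbf{z}^*\|_G^2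 .$$ That is, $\|\mathbf{z}^k-\mathbf{z}^*\|_G^2$ converges to $0$ at the Q-linear rate $O\big((1+\delta)^{-k}\big)$. Consequently, $\|\mathbf{x}^k-\mathbf{x}^*\|_{\tilde W}^2$ converges to $0$ at the R-linear rate $O\big((1+\delta)^{-k}\big)$.
   Context: Setting. Consider the problem $\min_{x\in\mathbb{R}^p}\bar f(x)=\frac1n\sum_{i=1}^n f_i(x)$. For $\mathbf{x}\in\mathbb{R}^{n\times p}$ with rows $x_{(1)}^{\mathrm T},\dots,x_{(n)}^{\mathrm T}$, put $\mathbf{f}(\mathbf{x})=\sum_{i=1}^n f_i(x_{(i)})$, and let $\nabla\mathbf{f}(\mathbf{x})\in\mathbb{R}^{n\times p}$ be the matrix whose $i$-th row is $\nabla f_i(x_{(i)})^{\mathrm T}$. $\mathbf{1}\in\mathbb{R}^n$ is the all-ones vector; $\succ,\succcurlyeq$ denote the Loewner order on symmetric matrices; $\lambda_{\min}$ is the smallest eigenvalue; $\|\cdot\|_{\mathrm F}$ is the Frobenius norm and $\langle A,B\rangle=\mathrm{trace}(A^{\mathrm T}B)$. Assumption 1 (mixing matrices). There is a connected undirected graph with vertex set $\{1,\dots,n\}$ and edge set $\mathcal{E}$, and $W=[w_{ij}]$, $\tilde W=[\tilde w_{ij}]$ satisfy: (1) if $i\ne j$ and $(i,j)\notin\mathcal{E}$ then $w_{ij}=\tilde w_{ij}=0$; (2) $W=W^{\mathrm T}$, $\tilde W=\tilde W^{\mathrm T}$; (3) $\mathrm{null}(W-\tilde W)=\mathrm{span}\{\mathbf{1}\}$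 and $\mathrm{null}(I-\tilde W)\supseteq\mathrm{span}\{\mathbf{1}\}$; (4) $\tilde W\succ0$ and $\frac{I+W}{2}\succcurlyeq\tilde W\succcurlyeq W$. Assumption 2. Each $f_i:\mathbb{R}^p\to\mathbb{R}$ is convex and differentiable with $\|\nabla f_i(x_a)-\nabla f_i(x_b)\|_2\le L_{f_i}\|x_a-x_b\|_2$ for all $x_a,x_b\in\mathbb{R}^p$, where $L_{f_i}\ge0$ is a constant. Assumption 3. The problem $\min_x\bar f(x)$ has a nonempty set of optimal solutions. EXTRA. Given $\alpha>0$ and $\mathbf{x}^0\in\mathbb{R}^{n\times p}$: $\mathbf{x}^1=W\mathbf{x}^0-\alpha\nabla\mathbf{f}(\mathbf{x}^0)$, and for $k=0,1,\dots$, $\mathbf{x}^{k+2}=(I+W)\mathbf{x}^{k+1}-\tilde W\mathbf{x}^k-\alpha[\nabla\mathbf{f}(\mathbf{x}^{k+1})-\nabla\mathbf{f}(\mathbf{x}^k)]$. Auxiliary objects. $U=(\tilde W-W)^{1/2}$ is the symmetric positive semidefinite square root of $\tilde W-W$; $\mathbf{q}^k=\sum_{t=0}^kU\mathbf{x}^t$; $\mathbf{z}^k=\begin{pmatrix}\mathbf{q}^k\\ \mathbf{x}^k\end{pmatrix}\in\mathbb{R}^{2n\times p}$; $G=\begin{pmatrix}I&\mathbf{0}\\ \mathbf{0}&\tilde W\end{pmatrix}$. For symmetric positive semidefinite $M$, $\|A\|_M=\sqrt{\mathrm{trace}(A^{\mathrm T}MA)}$. Restricted strong convexity. A differentiable convex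 function $h$ is restricted strongly convex with respect to a point $\tilde x$ with constant $\mu>0$ if $\langle\nabla h(x)-\nabla h(\tilde x),x-\tilde x\rangle\ge\mu\|x-\tilde x\|^2$ for all $x$ (Euclidean norm on $\mathbb{R}^p$, Frobenius norm on $\mathbb{R}^{n\times p}$). Rates. A nonnegative sequence converges R-linearly at rate $O((1+\delta)^{-k})$ if it is bounded by $C(1+\delta)^{-k}$ for some constant $C$. *)

(* Defs.v *)
From HB Require Import structures.
From mathcomp Require Import all_boot all_order all_algebra.
From mathcomp Require Import all_classical all_reals all_analysis.

Set Implicit Arguments.
Unset Strict Implicit.
Unset Printing Implicit Defensive.

Import Order.TTheory GRing.Theory Num.Theory.
Import numFieldNormedType.Exports.

Local Open Scope classical_set_scope.
Local Open Scope ring_scope.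

Section Matrices.
Variable R : realType.

Definition mx_inner m n (A B : 'M[R]_(m, n)) : R := \tr (A^T *m B).

(* On row vectors this is the Euclidean norm; the norm [`| _ |] of the library
   on matrices is the max norm. *)
Definition frobenius m n (A : 'M[R]_(m, n)) : R := Num.sqrt (mx_inner A A).

Definition wnorm m n (M : 'M[R]_m) (A : 'M[R]_(m, n)) : R :=
  Num.sqrt (\tr (A^T *m M *m A)).

Definition psdmx n (M : 'M[R]_n) : Prop :=
  M^T = M /\ forall v : 'cV[R]_n, 0 <= (v^T *m M *m v) 0 0.

Definition pdmx n (M : 'M[R]_n) : Prop :=
  M^T = M /\ forall v : 'cV[R]_n, v != 0 -> 0 < (v^T *m M *m v) 0 0.

Definition loewner_le n (A B : 'M[R]_n) : Prop := psdmx (B - A).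

Definition psd_sqrt n (U M : 'M[R]_n) : Prop := psdmx U /\ U *m U = M.

(* For a symmetric matrix of positive size the set is finite and nonempty,
   so this infimum is attained. *)
Definition lambda_min n (A : 'M[R]_n) : R :=
  inf [set a : R | eigenvalue A a].

Definition null_space n (A : 'M[R]_n) : set 'cV[R]_n := [set v | A *m v = 0].

Definition span_ones n : set 'cV[R]_n :=
  [set v | exists c : R, v = c *: const_mx 1].

End Matrices.

Section Functions.
Variable R : realType.

(* Points of R^p are row vectors 'rV_p, the case m = 1. *)
Definition gradient m n (h : 'M[R]_(m, n) -> R) (x : 'M[R]_(m, n)) :
    'M[R]_(m, n) :=
  \matrix_(i, j) 'D_(delta_mx i j) h x.

Definition is_minimizer (T : Type) (h : T -> R) (x : T) : Prop :=
  forall y, h x <= h y.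

Definition convex_differentiable m n (h : 'M[R]_(m, n) -> R) : Prop :=
  convex_function setT h /\ forall x, differentiable h x.

Definition restricted_strongly_convex m n (h : 'M[R]_(m, n) -> R)
    (xt : 'M[R]_(m, n)) (mu : R) : Prop :=
  [/\ convex_differentiable h, 0 < mu &
      forall x, mu * frobenius (x - xt) ^+ 2
                <= mx_inner (gradient h x - gradient h xt) (x - xt)].

Definition r_linear (u : nat -> R) (delta : R) : Prop :=
  exists C : R, forall k, u k <= C * (1 + delta) ^- k.

End Functions.

Section Extra.
Variables (R : realType) (n p : nat).

Definition mixing_matrices (E : rel 'I_n) (W Wt : 'M[R]_n) : Prop :=
  [/\ forall i j, i != j -> ~~ E i j -> W i j = 0 /\ Wt i j = 0,
      W^T = W /\ Wt^T = Wt,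
      null_space (W - Wt) = @span_ones R n /\
        @span_ones R n `<=` null_space (1%:M - Wt) &
      [/\ pdmx Wt, loewner_le Wt (2^-1 *: (1%:M + W)) & loewner_le W Wt]].

Definition connected_graph (E : rel 'I_n) : Prop :=
  symmetric E /\ forall i j, connect E i j.

Implicit Type f : 'I_n -> 'rV[R]_p -> R.

Definition smooth_convex f (L : 'I_n -> R) : Prop :=
  forall i, [/\ convex_differentiable (f i), 0 <= L i &
    forall xa xb, frobenius (gradient (f i) xa - gradient (f i) xb)
                  <= L i * frobenius (xa - xb)].

Definition fbar f (x : 'rV[R]_p) : R := n%:R^-1 * \sum_(i < n) f i x.

Definition fsum f (x : 'M[R]_(n, p)) : R := \sum_(i < n) f i (row i x).

Definition grad_rows f (x : 'M[R]_(n, p)) : 'M[R]_(n, p) :=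
  \matrix_(i < n) gradient (f i) (row i x).

Definition gfun f (W Wt : 'M[R]_n) (alpha : R) (x : 'M[R]_(n, p)) : R :=
  fsum f x + (4 * alpha)^-1 * wnorm (Wt - W) x ^+ 2.

Definition consensus (x : 'rV[R]_p) : 'M[R]_(n, p) := const_mx 1 *m x.

Definition extra f (W Wt : 'M[R]_n) (alpha : R) (x : nat -> 'M[R]_(n, p)) :
    Prop :=
  x 1%N = W *m x 0%N - alpha *: grad_rows f (x 0%N) /\
  forall k, x k.+2 = (1%:M + W) *m x k.+1 - Wt *m x k
                     - alpha *: (grad_rows f (x k.+1) - grad_rows f (x k)).

Definition qseq (U : 'M[R]_n) (x : nat -> 'M[R]_(n, p)) (k : nat) :
    'M[R]_(n, p) :=
  \sum_(t < k.+1) U *m x t.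

Definition zseq (U : 'M[R]_n) (x : nat -> 'M[R]_(n, p)) (k : nat) :
    'M[R]_(n + n, p) :=
  col_mx (qseq U x k) (x k).

Definition Gmx (Wt : 'M[R]_n) : 'M[R]_(n + n) := block_mx 1%:M 0 0 Wt.

End Extra.

(* Main.v *)
Require Import Defs.
From HB Require Import structures.
From mathcomp Require Import all_boot all_order all_algebra.
From mathcomp Require Import all_classical all_reals all_analysis.
From mathcomp Require Import ring lra.

Set Implicit Arguments.
Unset Strict Implicit.
Unset Printing Implicit Defensive.

Import Order.TTheory GRing.Theory Num.Theory.
Import numFieldNormedType.Exports.

Local Open Scope classical_set_scope.
Local Open Scope ring_scope.

(** The squared distance [|z^k - zs|_G^2 = |q^k - qs|^2 + |x^k - xs|_Wt^2] is a
    Lyapunov function.  Put [e = x^(k+1) - xs], [d = x^(k+1) - x^k] and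
    [M = I + W - 2 Wt], which is positive semidefinite.  Summed up, EXTRA is the
    primal-dual step
      [M e + Wt d = - U (q^(k+1) - qs) - alpha (grad f (x^k) - grad f (xs))],
      [q^(k+1) - q^k = U e]
    ([extra_error]).

    Testing this identity against [e] and inserting the restricted strong
    convexity of [g] gives a decrease of the Lyapunov function by at least
    [2 alpha mu |e|^2 + |d|_Wt^2 - 2 alpha <grad f (x^(k+1)) - grad f (x^k), e>]
    ([extra_descent]).  By Young's inequality, the Lipschitz bound and
    [lambda_min Wt |d|^2 <= |d|_Wt^2] ([lambda_min_le]), the step-size condition
    makes this at least [a |e|^2 + b |d|^2] with [a, b > 0].

    Conversely the new value of the Lyapunov function is at most
    [C (|e|^2 + |d|^2)] ([extra_lyapunov_bound]).  Only the dual part needs an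
    argument: [q^(k+1) - qs] lies in the range of [U], on which the symmetric
    matrix [U] is bounded below ([sym_range_bound]), and the identity above
    bounds [U (q^(k+1) - qs)].  Hence each step divides the Lyapunov function by
    at least [1 + min(a, b) / C] ([extra_contraction]), and both convergence
    claims follow by comparison with a geometric sequence. *)

(** * The Frobenius inner product *)

Section InnerProduct.
Variable R : realType.

Lemma mx_innerE m n (A B : 'M[R]_(m, n)) :
  mx_inner A B = \sum_i \sum_j A i j * B i j.
Proof.
rewrite exchange_big; apply: eq_bigr => j _; rewrite mxE.
by apply: eq_bigr => i _; rewrite mxE.
Qed.

Lemma mx_innerC m n (A B : 'M[R]_(m, n)) : mx_inner A B = mx_inner B A.
Proof. by rewrite /mx_inner -mxtrace_tr trmx_mul trmxK. Qed.

Lemma mx_innerDr m n (A B C : 'M[R]_(m, n)) :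
  mx_inner A (B + C) = mx_inner A B + mx_inner A C.
Proof. by rewrite /mx_inner mulmxDr mxtraceD. Qed.

Lemma mx_innerNr m n (A B : 'M[R]_(m, n)) : mx_inner A (- B) = - mx_inner A B.
Proof. by rewrite /mx_inner mulmxN raddfN. Qed.

Lemma mx_innerZr m n a (A B : 'M[R]_(m, n)) :
  mx_inner A (a *: B) = a * mx_inner A B.
Proof. by rewrite /mx_inner -scalemxAr mxtraceZ. Qed.

Lemma mx_innerDl m n (A B C : 'M[R]_(m, n)) :
  mx_inner (A + B) C = mx_inner A C + mx_inner B C.
Proof. by rewrite mx_innerC mx_innerDr !(mx_innerC C). Qed.

Lemma mx_innerNl m n (A B : 'M[R]_(m, n)) : mx_inner (- A) B = - mx_inner A B.
Proof. by rewrite mx_innerC mx_innerNr mx_innerC. Qed.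

Lemma mx_innerZl m n a (A B : 'M[R]_(m, n)) :
  mx_inner (a *: A) B = a * mx_inner A B.
Proof. by rewrite mx_innerC mx_innerZr mx_innerC. Qed.

Definition mx_inner_lin :=
  (mx_innerDl, mx_innerDr, mx_innerNl, mx_innerNr, mx_innerZl, mx_innerZr).

Lemma mx_inner_adjoint m n k (M : 'M[R]_(m, k)) (A : 'M[R]_(m, n)) B :
  mx_inner A (M *m B) = mx_inner (M^T *m A) B.
Proof. by rewrite /mx_inner trmx_mul trmxK mulmxA. Qed.

Lemma mx_inner_ge0 m n (A : 'M[R]_(m, n)) : 0 <= mx_inner A A.
Proof.
by rewrite mx_innerE; do 2![apply: sumr_ge0 => ? _]; rewrite -expr2 sqr_ge0.
Qed.

Lemma mx_inner_eq0 m n (A : 'M[R]_(m, n)) : (mx_inner A A == 0) = (A == 0).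
Proof.
apply/idP/eqP => [|->]; last by rewrite /mx_inner mulmx0 mxtrace0.
rewrite mx_innerE psumr_eq0 => [/allP A0|? _]; last first.
  by apply: sumr_ge0 => ? _; rewrite -expr2 sqr_ge0.
apply/matrixP => i j; rewrite mxE; have := A0 i; rewrite mem_index_enum.
move=> /(_ isT); rewrite psumr_eq0 => [/allP /(_ j)|? _]; last first.
  by rewrite -expr2 sqr_ge0.
by rewrite mem_index_enum -expr2 sqrf_eq0 => /(_ isT)/eqP.
Qed.

Lemma frobenius_sqr m n (A : 'M[R]_(m, n)) : frobenius A ^+ 2 = mx_inner A A.
Proof. by rewrite sqr_sqrtr ?mx_inner_ge0. Qed.

Lemma mx_inner_rows m n (A B : 'M[R]_(m, n)) :
  mx_inner A B = \sum_i mx_inner (row i A) (row i B).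
Proof.
rewrite mx_innerE; apply: eq_bigr => i _; rewrite mx_innerE big_ord1.
by apply: eq_bigr => j _; rewrite !mxE.
Qed.

Lemma mx_inner_cols m n (A B : 'M[R]_(m, n)) :
  mx_inner A B = \sum_j mx_inner (col j A) (col j B).
Proof.
rewrite mx_innerE exchange_big; apply: eq_bigr => j _; rewrite mx_innerE.
by apply: eq_bigr => i _; rewrite big_ord1 !mxE.
Qed.

Lemma col_mulmx m k n (M : 'M[R]_(m, k)) (A : 'M[R]_(k, n)) j :
  col j (M *m A) = M *m col j A.
Proof. by rewrite !colE mulmxA. Qed.

(** Nonnegativity of the squared norm of [eta B - A]. *)
Lemma mx_inner_young m n (A B : 'M[R]_(m, n)) (eta : R) : 0 < eta ->
  2 * mx_inner A B <= eta^-1 * mx_inner A A + eta * mx_inner B B.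
Proof.
move=> eta_gt0; have := mx_inner_ge0 (eta *: B - A).
rewrite !mx_inner_lin (mx_innerC B A) => sq_ge0.
rewrite -(ler_pM2l eta_gt0) mulrDr mulVKf ?gt_eqF //; nra.
Qed.

(** Nonnegativity of the squared norm of [<B, B> A - <A, B> B]. *)
Lemma mx_inner_CauchySchwarz m n (A B : 'M[R]_(m, n)) :
  mx_inner A B ^+ 2 <= mx_inner A A * mx_inner B B.
Proof.
have [->|B_neq0] := eqVneq B 0.
  by rewrite /mx_inner !mulmx0 mxtrace0 mulr0 expr0n.
have BB_gt0 : 0 < mx_inner B B by rewrite lt0r mx_inner_eq0 B_neq0 mx_inner_ge0.
have := mx_inner_ge0 (mx_inner B B *: A - mx_inner A B *: B).
rewrite !mx_inner_lin (mx_innerC B A) => sq_ge0.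
rewrite -(ler_pM2l BB_gt0); nra.
Qed.

Lemma mx_inner_sqrD_le m n (A B : 'M[R]_(m, n)) :
  mx_inner (A + B) (A + B) <= 2 * mx_inner A A + 2 * mx_inner B B.
Proof.
have := mx_inner_ge0 (A - B); rewrite !mx_inner_lin (mx_innerC B A); lra.
Qed.

(** Cauchy--Schwarz entry by entry: the operator norm is at most the Frobenius
    norm. *)
Lemma mx_inner_mulmx_le m k n (M : 'M[R]_(m, k)) (A : 'M[R]_(k, n)) :
  mx_inner (M *m A) (M *m A) <= mx_inner M M * mx_inner A A.
Proof.
rewrite (mx_inner_rows M M) (mx_inner_cols A A) mulr_suml mx_innerE.
apply: ler_sum => i _; rewrite mulr_sumr; apply: ler_sum => j _.
have -> : (M *m A) i j = mx_inner (row i M)^T (col j A).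
  rewrite mx_innerE mxE; apply: eq_bigr => l _.
  by rewrite big_ord1 !mxE.
rewrite -expr2 (le_trans (mx_inner_CauchySchwarz _ _)) //.
by rewrite /mx_inner trmxK mxtrace_mulC.
Qed.

(** For symmetric [U] the kernels of [U] and [U *m U] agree, so [U] factors as
    [B *m (U *m U)]: on the range of [U], the map [U] is bounded below. *)
Lemma sym_range_bound n (U : 'M[R]_n) : U^T = U ->
  exists2 c : R, 0 <= c & forall p (S : 'M[R]_(n, p)),
    mx_inner (U *m S) (U *m S) <= c * mx_inner (U *m (U *m S)) (U *m (U *m S)).
Proof.
move=> symU; have /submxP[B UE] : (U <= U *m U)%MS.
  rewrite submxE -mx_inner_eq0 mx_inner_adjoint symU mulmxA mulmx_coker.
  by rewrite /mx_inner trmx0 mul0mx mxtrace0.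
exists (mx_inner B B) => [|p S]; first exact: mx_inner_ge0.
rewrite {1 2}UE (_ : B *m (U *m U) *m S = B *m (U *m (U *m S))).
  exact: mx_inner_mulmx_le.
by rewrite !mulmxA.
Qed.

End InnerProduct.

(** * Positive semidefinite matrices *)

Section PositiveSemidefinite.
Variable R : realType.

Lemma quad_formE n (M : 'M[R]_n) (v : 'cV[R]_n) :
  (v^T *m M *m v) 0 0 = mx_inner v (M *m v).
Proof. by rewrite /mx_inner /mxtrace big_ord1 mulmxA. Qed.

Lemma psdmx_inner_ge0 n p (M : 'M[R]_n) (A : 'M[R]_(n, p)) :
  psdmx M -> 0 <= mx_inner A (M *m A).
Proof.
case=> _ M_ge0; rewrite mx_inner_cols; apply: sumr_ge0 => j _.
by rewrite col_mulmx -quad_formE.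
Qed.

Lemma pdmx_psd n (M : 'M[R]_n) : pdmx M -> psdmx M.
Proof.
case=> symM M_gt0; split=> // v; have [->|/M_gt0/ltW//] := eqVneq v 0.
by rewrite mulmx0 mxE.
Qed.

Lemma psdmx_scale n (a : R) (M : 'M[R]_n) : 0 <= a -> psdmx M -> psdmx (a *: M).
Proof.
move=> a_ge0 [symM M_ge0]; split=> [|v]; first by rewrite linearZ /= symM.
by rewrite -scalemxAr -scalemxAl mxE mulr_ge0.
Qed.

Lemma wnorm_sqr n p (M : 'M[R]_n) (A : 'M[R]_(n, p)) :
  psdmx M -> wnorm M A ^+ 2 = mx_inner A (M *m A).
Proof.
move=> psdM; rewrite /wnorm -mulmxA -/(mx_inner A (M *m A)).
by rewrite sqr_sqrtr ?psdmx_inner_ge0.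
Qed.

(** Expand [0 <= <v - t N v, N (v - t N v)>] at [t = 1 / c], where [c] bounds
    the quadratic form of [N]. *)
Lemma psdmx_mulmx_bound n (N : 'M[R]_n) : psdmx N ->
  exists2 c : R, 0 < c & forall v : 'cV[R]_n,
    mx_inner (N *m v) (N *m v) <= c * mx_inner v (N *m v).
Proof.
move=> psdN; have [symN _] := psdN.
pose c := mx_inner N N + 1.
have c_gt0 : 0 < c by rewrite ltr_wpDl ?mx_inner_ge0.
have le_c (w : 'cV[R]_n) : mx_inner w (N *m w) <= c * mx_inner w w.
  have := mx_inner_young w (N *m w) ltr01; have := mx_inner_mulmx_le N w.
  rewrite invr1 !mul1r /c; have := mx_inner_ge0 w.
  have := mx_inner_ge0 N; nra.
exists c => // v; set w := N *m v.
have := psdmx_inner_ge0 (v - c^-1 *: w) psdN.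
rewrite mulmxBr -scalemxAr !mx_inner_lin (mx_inner_adjoint N v w) symN -/w.
(* The term [c^-2 <w, N w>] of the expansion is at most [c^-1 <w, w>]. *)
have := le_c w; rewrite -(ler_pM2l (_ : 0 < c^-1 * c^-1)); last first.
  by rewrite mulr_gt0 ?invr_gt0.
move=> le1 le2.
have : 0 <= mx_inner v w - c^-1 * mx_inner w w.
  have : c^-1 * c^-1 * (c * mx_inner w w) = c^-1 * mx_inner w w.
    by field; rewrite gt_eqF.
  lra.
by rewrite subr_ge0 ler_pdivrMl.
Qed.

(** The infimum [m] of the Rayleigh quotient is an eigenvalue: [A - m I] is
    positive semidefinite, and if it were invertible it would be coercive, so
    that [m] could be increased. *)
Lemma lambda_min_le n p (A : 'M[R]_n) (X : 'M[R]_(n, p)) : (0 < n)%N ->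
  psdmx A -> lambda_min A * mx_inner X X <= mx_inner X (A *m X).
Proof.
case: n A X => // n A X _ psdA; have [symA _] := psdA.
pose S := [set t : R | forall v : 'cV[R]_n.+1,
                         t * mx_inner v v <= mx_inner v (A *m v)].
have S0 : S 0 by move=> v; rewrite mul0r psdmx_inner_ge0.
pose v1 : 'cV[R]_n.+1 := const_mx 1.
have v1_gt0 : 0 < mx_inner v1 v1.
  rewrite lt0r mx_inner_ge0 mx_inner_eq0 andbT.
  by apply/eqP => /matrixP/(_ 0 0); rewrite !mxE => /eqP; rewrite oner_eq0.
have ubS : has_ubound S.
  exists (mx_inner v1 (A *m v1) / mx_inner v1 v1) => t /(_ v1).
  by rewrite ler_pdivlMr.
pose m := sup S.
have Sm : S m.
  move=> v; have [->|v_neq0] := eqVneq v 0.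
    by rewrite /mx_inner !mulmx0 mxtrace0 mulr0.
  have v_gt0 : 0 < mx_inner v v.
    by rewrite lt0r mx_inner_ge0 mx_inner_eq0 v_neq0.
  rewrite -ler_pdivlMr //; apply: ge_sup; first by exists 0.
  by move=> t /(_ v); rewrite ler_pdivlMr.
have NE (v : 'cV[R]_n.+1) :
    mx_inner v ((A - m%:M) *m v) = mx_inner v (A *m v) - m * mx_inner v v.
  by rewrite mulmxBl mul_scalar_mx !mx_inner_lin.
have psdN : psdmx (A - m%:M).
  split=> [|v]; first by rewrite raddfB /= symA tr_scalar_mx.
  by rewrite quad_formE NE subr_ge0.
have eig_m : eigenvalue A m.
  rewrite /eigenvalue /eigenspace kermx_eq0 row_free_unit.
  apply/negP => unitN; have [c c_gt0 le_c] := psdmx_mulmx_bound psdN.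
  pose b := mx_inner (invmx (A - m%:M)) (invmx (A - m%:M)) * c + 1.
  have b_gt0 : 0 < b by rewrite ltr_wpDl // mulr_ge0 ?mx_inner_ge0 ?ltW.
  (* [|v|^2 <= b <v, N v>] for [N = A - m I], by [v = N^-1 (N v)]. *)
  have : S (m + b^-1).
    move=> v; rewrite mulrDl -lerBrDl -NE mulrC ler_pdivrMr //.
    rewrite -{1 2}(mulKmx unitN v) (le_trans (mx_inner_mulmx_le _ _)) //.
    rewrite mulrDr mulr1 ler_wpDr ?psdmx_inner_ge0 // [leRHS]mulrC -mulrA.
    by rewrite ler_wpM2l ?mx_inner_ge0.
  move=> /(ub_le_sup ubS); rewrite -/m gerDl leNgt invr_gt0 b_gt0 //.
(* [lambda_min] is an infimum, so the spectrum must be bounded below. *)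
have lb_eig : has_lbound [set a : R | eigenvalue A a].
  exists 0 => a /= /eigenvalueP[v vA v_neq0].
  have vT_gt0 : 0 < mx_inner v^T v^T.
    by rewrite lt0r mx_inner_ge0 mx_inner_eq0 trmx_eq0 v_neq0.
  have := psdmx_inner_ge0 v^T psdA.
  by rewrite -{1}symA -trmx_mul vA linearZ /= mx_innerZr pmulr_lge0.
have le_m : lambda_min A <= m by exact: ge_inf.
rewrite mx_inner_cols (mx_inner_cols X (A *m X)) mulr_sumr.
apply: ler_sum => j _; rewrite col_mulmx (le_trans _ (Sm _)) //.
by rewrite ler_wpM2r ?mx_inner_ge0.
Qed.

End PositiveSemidefinite.

(** * The gradient of [gfun] *)

Section Gradient.
Variable R : realType.

(** The difference quotient is affine in [h], hence has the stated limit. *)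
Lemma is_derive_quad_form n p (H : 'M[R]_n) (x v : 'M[R]_(n, p)) : H^T = H ->
  is_derive x v (fun y => mx_inner y (H *m y)) (2 * mx_inner v (H *m x)).
Proof.
move=> symH; pose quot h := 2 * mx_inner v (H *m x) + h * mx_inner v (H *m v).
suff cvg_quot : (fun h => h^-1 *: (((fun y => mx_inner y (H *m y)) \o shift x)
                            (h *: v) - mx_inner x (H *m x))) @ 0^'
    --> (2 * mx_inner v (H *m x) : R).
  by split; [apply/cvg_ex; exists (2 * mx_inner v (H *m x)) | exact: cvg_lim].
have : quot @ 0^' --> (2 * mx_inner v (H *m x) + 0 * mx_inner v (H *m v)).
  apply: cvgD; first exact: cvg_cst.
  by apply: cvgM; [exact: cvg_within | exact: cvg_cst].
rewrite mul0r addr0; apply: cvg_trans; apply: near_eq_cvg; near=> h.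
have h_neq0 : h != 0 by near: h; exact: nbhs_dnbhs_neq.
rewrite /quot /= mulmxDr -scalemxAr !mx_inner_lin.
rewrite (mx_inner_adjoint H x v) symH (mx_innerC (H *m x)) -[LHS]mulr1.
by rewrite -(mulfV h_neq0) /GRing.scale /=; field.
Unshelve. all: by end_near. Qed.

Lemma is_derive_row n p (h : 'rV[R]_p -> R) (i : 'I_n) (x v : 'M[R]_(n, p)) :
  differentiable h (row i x) ->
  is_derive x v (h \o row i) ('D_(row i v) h (row i x)).
Proof.
move=> /(diff_derivable (v := row i v)) dh.
have quotE : (fun t : R => t^-1 *: (((h \o row i) \o shift x) (t *: v)
                                    - (h \o row i) x)) =
    (fun t : R => t^-1 *: ((h \o shift (row i x)) (t *: row i v)
                           - h (row i x))).
  apply/funext => t /=; congr (_ *: (h _ - _)).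
  by apply/rowP => j; rewrite !mxE.
by split; rewrite /derivable /derive quotE.
Qed.

Lemma mx_inner_delta n p (A : 'M[R]_(n, p)) i j :
  mx_inner (delta_mx i j) A = A i j.
Proof.
rewrite mx_innerE (bigD1 i) //= (bigD1 j) //= mxE !eqxx mul1r.
rewrite big1 => [|l l_neq_j]; last by rewrite mxE (negbTE l_neq_j) andbF mul0r.
rewrite big1 ?addr0 // => k k_neq_i; apply: big1 => l _.
by rewrite mxE (negbTE k_neq_i) mul0r.
Qed.

Lemma gradient_gfun n p (f : 'I_n -> 'rV[R]_p -> R) (W Wt : 'M[R]_n) alpha x :
  (forall i y, differentiable (f i) y) -> psdmx (Wt - W) ->
  gradient (gfun f W Wt alpha) x =
  grad_rows f x + (2 * alpha)^-1 *: ((Wt - W) *m x).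
Proof.
move=> df psdH; have [symH _] := psdH.
have gfunE : gfun f W Wt alpha = \sum_(k < n) (f k \o row k) +
    (4 * alpha)^-1 \*: (fun y => mx_inner y ((Wt - W) *m y)).
  apply/funext => y; rewrite /gfun wnorm_sqr //.
  by rewrite /GRing.add /= fct_sumE.
apply/matrixP => i j; rewrite !mxE gfunE.
have sum_d : is_derive x (delta_mx i j) (\sum_(k < n) (f k \o row k))
    (\sum_(k < n) 'D_(row k (delta_mx i j)) (f k) (row k x)).
  by apply: is_derive_sum => k; exact: is_derive_row.
have quad_d := is_deriveZ (4 * alpha)^-1
  (is_derive_quad_form x (delta_mx i j) symH).
rewrite (derive_val (is_derive := is_deriveD sum_d quad_d)) (bigD1 i) //=.
rewrite big1 ?addr0 => [|k k_neq_i]; last first.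
  have -> : row k (delta_mx i j : 'M[R]_(n, p)) = 0; last exact: derive0.
  by apply/rowP => l; rewrite !mxE (negbTE k_neq_i).
have -> : row i (delta_mx i j : 'M[R]_(n, p)) = delta_mx 0 j.
  by apply/rowP => l; rewrite !mxE eqxx.
congr (_ + _); rewrite mx_inner_delta.
rewrite [LHS]mulrA mxE; congr (_ * _).
by rewrite !invfM mulrAC; congr (_ * _); field.
Qed.

End Gradient.

(** * The EXTRA recursion *)

Section ExtraStep.
Variable R : realType.

Lemma grad_rows_lipschitz n p (f : 'I_n -> 'rV[R]_p -> R) L x y :
  smooth_convex f L ->
  mx_inner (grad_rows f x - grad_rows f y) (grad_rows f x - grad_rows f y)
  <= (\big[Num.max/0]_(i < n) L i) ^+ 2 * mx_inner (x - y) (x - y).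
Proof.
move=> hf; rewrite mx_inner_rows (mx_inner_rows (x - y)) mulr_sumr.
apply: ler_sum => i _; rewrite !raddfB /= !rowK -!frobenius_sqr -exprMn.
have [_ L_ge0 lipf] := hf i; have L_le : L i <= \big[Num.max/0]_(i < n) L i.
  exact: le_bigmax.
rewrite ler_sqr ?nnegrE ?sqrtr_ge0 ?mulr_ge0 ?sqrtr_ge0 //; last first.
  exact: le_trans L_le.
by rewrite (le_trans (lipf _ _)) // ler_wpM2r ?sqrtr_ge0.
Qed.

Lemma wnorm_Gmx_sqr n p (Wt : 'M[R]_n) (A B : 'M[R]_(n, p)) : psdmx Wt ->
  wnorm (Gmx Wt) (col_mx A B) ^+ 2 = mx_inner A A + mx_inner B (Wt *m B).
Proof.
move=> psdWt; have -> : wnorm (Gmx Wt) (col_mx A B) =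
    Num.sqrt (mx_inner A A + mx_inner B (Wt *m B)).
  rewrite /wnorm /Gmx -mulmxA mul_block_col tr_col_mx mul_row_col.
  by rewrite !mul0mx mul1mx addr0 add0r mxtraceD.
by rewrite sqr_sqrtr // addr_ge0 ?mx_inner_ge0 ?psdmx_inner_ge0.
Qed.

Lemma qseqS n p (U : 'M[R]_n) (x : nat -> 'M[R]_(n, p)) k :
  qseq U x k.+1 = qseq U x k + U *m x k.+1.
Proof. by rewrite /qseq big_ord_recr. Qed.

(** Summing the two-step recursion: its increments telescope. *)
Lemma extra_cumulative n p (f : 'I_n -> 'rV[R]_p -> R) W Wt U alpha
    (x : nat -> 'M[R]_(n, p)) :
  extra f W Wt alpha x -> U *m U = Wt - W -> forall k,
  x k.+1 = Wt *m x k - U *m qseq U x k - alpha *: grad_rows f (x k).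
Proof.
move=> [x1E xE] UU; elim=> [|k IHk].
  by rewrite x1E /qseq big_ord1 mulmxA UU mulmxBl opprB addrCA subrr addr0.
rewrite xE qseqS mulmxDr mulmxA UU mulmxDl mul1mx {1}IHk !mulmxBl scalerBr.
apply/matrixP => i j; rewrite !mxE; ring.
Qed.

(** The recursion in terms of the errors [x (k + 1) - xs] and
    [q (k + 1) - qs] and of the step [x (k + 1) - x k]: the fixed-point
    relations remove [xs] and [qs]. *)
Lemma extra_error n p (f : 'I_n -> 'rV[R]_p -> R) W Wt U alpha
    (x : nat -> 'M[R]_(n, p)) xs qs :
  extra f W Wt alpha x -> U *m U = Wt - W ->
  (1%:M + W - 2 *: Wt) *m xs = 0 -> U *m qs + alpha *: grad_rows f xs = 0 ->
  forall k,
  (1%:M + W - 2 *: Wt) *m (x k.+1 - xs) + Wt *m (x k.+1 - x k) =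
  - (U *m (qseq U x k.+1 - qs)) - alpha *: (grad_rows f (x k) - grad_rows f xs).
Proof.
move=> hx UU Mxs kkt k.
have xS := extra_cumulative hx UU k.
rewrite !mulmxBr Mxs subr0 qseqS mulmxDr mulmxA UU scalerBr.
rewrite (_ : U *m qs = - (alpha *: grad_rows f xs)); last first.
  by apply/eqP; rewrite -addr_eq0 kkt.
rewrite !mulmxBl !mulmxDl mul1mx {1}xS -scalemxAl.
apply/matrixP => i j; rewrite !mxE; ring.
Qed.

(** Restricted strong convexity, tested on [e], is turned by the recursion into
    a decrease of the Lyapunov function.  The term [<U e, U e>], which [g] has
    in excess of [f], compensates exactly the square of the increment [U e] of
    [q]. *)
Lemma extra_descent n p (U Wt M : 'M[R]_n) (alpha mu : R)
    (e d s D1 D0 : 'M[R]_(n, p)) :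
  U^T = U -> Wt^T = Wt -> psdmx M -> 0 < alpha ->
  M *m e + Wt *m d = - (U *m s) - alpha *: D0 ->
  mu * mx_inner e e <= mx_inner (D1 + D0 + (2 * alpha)^-1 *: (U *m (U *m e))) e ->
  mx_inner s s + mx_inner e (Wt *m e)
  + 2 * alpha * mu * mx_inner e e + mx_inner d (Wt *m d)
  - 2 * alpha * mx_inner D1 e
  <= mx_inner (s - U *m e) (s - U *m e) + mx_inner (e - d) (Wt *m (e - d)).
Proof.
move=> symU symWt psdM al_gt0 rec rsc.
have Me_ge0 := psdmx_inner_ge0 e psdM.
have /(congr1 (mx_inner e)) := rec.
rewrite mulmxBr !mx_inner_lin (mx_inner_adjoint U e s) symU => recE.
have Wed : mx_inner d (Wt *m e) = mx_inner e (Wt *m d).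
  by rewrite mx_inner_adjoint symWt mx_innerC.
move: rsc; rewrite !mx_inner_lin (mx_innerC (U *m (U *m e)) e).
rewrite (mx_inner_adjoint U e) symU -(ler_pM2l (_ : 0 < 2 * alpha)); last first.
  by rewrite mulr_gt0.
rewrite [leRHS]mulrDr mulVKf ?gt_eqF ?mulr_gt0 // => rsc.
rewrite Wed (mx_innerC s (U *m e)); move: recE rsc.
rewrite (mx_innerC e D0) => recE rsc; nra.
Qed.

(** Both parts of the Lyapunov function are controlled by [e] and [d]: the dual
    part [s] lies in the range of [U], where [U] is bounded below, and the
    recursion expresses [U s] through [e] and [d]. *)
Lemma extra_lyapunov_bound n (U Wt M : 'M[R]_n) (alpha Lf : R) : U^T = U ->
  exists2 C : R, 0 < C & forall p (e d S D0 : 'M[R]_(n, p)),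
    M *m e + Wt *m d = - (U *m (U *m S)) - alpha *: D0 ->
    mx_inner D0 D0 <= Lf ^+ 2 * mx_inner (e - d) (e - d) ->
    mx_inner (U *m S) (U *m S) + mx_inner e (Wt *m e)
    <= C * (mx_inner e e + mx_inner d d).
Proof.
move=> symU; have [cU cU_ge0 le_cU] := sym_range_bound symU.
pose kM := mx_inner M M; pose kW := mx_inner Wt Wt.
have kM_ge0 : 0 <= kM := mx_inner_ge0 M.
have kW_ge0 : 0 <= kW := mx_inner_ge0 Wt.
have aL_ge0 : 0 <= alpha ^+ 2 * Lf ^+ 2 by rewrite mulr_ge0 ?sqr_ge0.
pose K := 4 * kM + 4 * kW + 4 * (alpha ^+ 2 * Lf ^+ 2).
have K_ge0 : 0 <= K by rewrite /K; lra.
exists (cU * K + (1 + kW)) => [|p e d S D0 rec D0_le].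
  by rewrite ltr_wpDl ?mulr_ge0 //; lra.
have E_ge0 := mx_inner_ge0 e; have D_ge0 := mx_inner_ge0 d.
have Me_le := mx_inner_mulmx_le M e; have We_le := mx_inner_mulmx_le Wt e.
have Wd_le := mx_inner_mulmx_le Wt d.
have eWe : mx_inner e (Wt *m e) <= (1 + kW) * (mx_inner e e + mx_inner d d).
  by have := mx_inner_young e (Wt *m e) ltr01; rewrite invr1 !mul1r; nra.
have US : mx_inner (U *m (U *m S)) (U *m (U *m S))
          <= K * (mx_inner e e + mx_inner d d).
  have -> : U *m (U *m S) = - (M *m e + Wt *m d + alpha *: D0).
    by rewrite rec subrK opprK.
  rewrite mx_innerNl mx_innerNr opprK.
  have le1 := mx_inner_sqrD_le (M *m e + Wt *m d) (alpha *: D0).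
  have le2 := mx_inner_sqrD_le (M *m e) (Wt *m d).
  have le3 : mx_inner (e - d) (e - d) <= 2 * mx_inner e e + 2 * mx_inner d d.
    by have := mx_inner_sqrD_le e (- d); rewrite !mx_innerNl !mx_innerNr opprK.
  have le4 : mx_inner (alpha *: D0) (alpha *: D0)
      <= alpha ^+ 2 * Lf ^+ 2 * (2 * mx_inner e e + 2 * mx_inner d d).
    rewrite mx_innerZl mx_innerZr mulrA -expr2 -mulrA ler_wpM2l ?sqr_ge0 //.
    by rewrite (le_trans D0_le) // ler_wpM2l ?sqr_ge0.
  rewrite -/kM in Me_le; rewrite -/kW in Wd_le; rewrite (le_trans le1) // /K.
  have := mulr_ge0 kM_ge0 D_ge0; have := mulr_ge0 kW_ge0 E_ge0.
  lra.
rewrite mulrDl lerD // (le_trans (le_cU _ _)) // -mulrA.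
by rewrite ler_wpM2l.
Qed.

End ExtraStep.

(** * Linear convergence *)

Section LinearConvergence.
Variable R : realType.

Lemma r_linear_of_contraction (u : nat -> R) (delta : R) : 0 < delta ->
  (forall k, (1 + delta) * u k.+1 <= u k) -> r_linear u delta.
Proof.
move=> delta_gt0 u_contr; have q_gt0 : 0 < 1 + delta by lra.
exists (u 0%N); elim=> [|k IHk]; first by rewrite expr0 invr1 mulr1.
by rewrite exprS invfM mulrCA ler_pdivlMl // (le_trans (u_contr k)).
Qed.

Lemma r_linear_cvg0 (u : nat -> R) (delta : R) : 0 < delta ->
  (forall k, 0 <= u k) -> r_linear u delta -> u @ \oo --> (0 : R).
Proof.
move=> delta_gt0 u_ge0 [C u_le].
have ratio_lt1 : `|(1 + delta)^-1| < 1.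
  by rewrite ger0_norm ?invr_ge0 ?invf_lt1; lra.
apply: (@squeeze_cvgr _ _ _ _ (cst 0) (fun k => C * (1 + delta)^-1 ^+ k)).
- by near=> k; rewrite /= u_ge0 exprVn u_le.
- exact: cvg_cst.
- rewrite -[X in _ --> X](mulr0 C); apply: cvgM; first exact: cvg_cst.
  exact: cvg_expr.
Unshelve. all: by end_near. Qed.

(** The margin in the step-size condition leaves room for a Young weight [eta]
    with [alpha * Lf ^+ 2 / lambda_min Wt < eta < 2 * mu]; the decrease then
    dominates a multiple of [<e, e> + <d, d>], and thereby of the new value of
    the Lyapunov function. *)
Lemma extra_contraction n p (f : 'I_n -> 'rV[R]_p -> R) L (W Wt U : 'M[R]_n)
    alpha mu (xs qs : 'M[R]_(n, p)) :
  (0 < n)%N -> smooth_convex f L -> psdmx Wt ->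
  psdmx (1%:M + W - 2 *: Wt) -> psd_sqrt U (Wt - W) -> 0 < alpha ->
  (1%:M + W - 2 *: Wt) *m xs = 0 -> U *m xs = 0 ->
  (exists P : 'M[R]_(n, p), qs = U *m P) ->
  U *m qs + alpha *: grad_rows f xs = 0 ->
  restricted_strongly_convex (gfun f W Wt alpha) xs mu ->
  alpha < 2 * mu * lambda_min Wt / (\big[Num.max/0]_(i < n) L i) ^+ 2 ->
  exists2 delta : R, 0 < delta & forall x, extra f W Wt alpha x -> forall k,
    (1 + delta) * wnorm (Gmx Wt) (zseq U x k.+1 - col_mx qs xs) ^+ 2
    <= wnorm (Gmx Wt) (zseq U x k - col_mx qs xs) ^+ 2.
Proof.
move=> n_gt0 hf psdWt psdM [psdU UU] al_gt0 Mxs Uxs [P qsE] kkt.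
move=> [_ mu_gt0 rsc]; set Lf := \big[_/_]_(_ < _) _ => step.
have [symWt _] := psdWt; have [symU _] := psdU.
have psdH : psdmx (Wt - W).
  rewrite -UU; split=> [|v]; first by rewrite trmx_mul symU.
  by rewrite quad_formE -mulmxA mx_inner_adjoint symU mx_inner_ge0.
set lam := lambda_min Wt in step.
(* If [Lf = 0] the step-size bound is [_ / 0 = 0], below [alpha]. *)
have Lf2_gt0 : 0 < Lf ^+ 2.
  rewrite lt0r sqr_ge0 andbT; apply/eqP => Lf0; move: step.
  by rewrite Lf0 invr0 mulr0 => /(lt_trans al_gt0); rewrite ltxx.
have aL_lt : alpha * Lf ^+ 2 < 2 * mu * lam by rewrite -ltr_pdivlMr.
have aL_gt0 : 0 < alpha * Lf ^+ 2 by rewrite mulr_gt0.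
have lam_gt0 : 0 < lam.
  have mu2_gt0 : 0 < 2 * mu by rewrite mulr_gt0.
  by rewrite -(pmulr_rgt0 lam mu2_gt0) (lt_trans aL_gt0).
have ratio_lt : alpha * Lf ^+ 2 / lam < 2 * mu by rewrite ltr_pdivrMr.
have ratio_gt0 : 0 < alpha * Lf ^+ 2 / lam by rewrite divr_gt0.
(* The midpoint of the admissible interval for [eta]. *)
pose eta := (alpha * Lf ^+ 2 / lam + 2 * mu) / 2.
have eta_gt0 : 0 < eta by rewrite /eta; lra.
pose a := alpha * (2 * mu - eta).
have a_gt0 : 0 < a by rewrite mulr_gt0 // /eta; lra.
pose b := lam - alpha * Lf ^+ 2 / eta.
have b_gt0 : 0 < b.
  rewrite subr_gt0 ltr_pdivrMr // [ltRHS]mulrC -ltr_pdivrMr // /eta; lra.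
have [C C_gt0 lyap_le] :=
  @extra_lyapunov_bound R n U Wt (1%:M + W - 2 *: Wt) alpha Lf symU.
pose c := Num.min a b.
have c_gt0 : 0 < c by rewrite lt_min a_gt0.
exists (c / C) => [|x hx k]; first by rewrite divr_gt0.
rewrite /zseq !opp_col_mx !add_col_mx !wnorm_Gmx_sqr //.
pose e := x k.+1 - xs; pose d := x k.+1 - x k; pose s := qseq U x k.+1 - qs.
pose D1 := grad_rows f (x k.+1) - grad_rows f (x k).
pose D0 := grad_rows f (x k) - grad_rows f xs.
have xkE : x k - xs = e - d by rewrite /e /d opprB [RHS]addrC subrKA.
have qkE : qseq U x k - qs = s - U *m e.
  by rewrite /s /e mulmxBr Uxs subr0 qseqS addrAC addrK.
have [S sE] : exists S, s = U *m S.
  by exists (\sum_(t < k.+2) x t - P); rewrite mulmxBr mulmx_sumr /s qsE.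
have rec := extra_error hx UU Mxs kkt k; rewrite -/e -/d -/s -/D0 in rec.
have D0_le : mx_inner D0 D0 <= Lf ^+ 2 * mx_inner (e - d) (e - d).
  by rewrite -xkE grad_rows_lipschitz.
have D1_le : mx_inner D1 D1 <= Lf ^+ 2 * mx_inner d d.
  exact: grad_rows_lipschitz.
have rsc_e : mu * mx_inner e e
    <= mx_inner (D1 + D0 + (2 * alpha)^-1 *: (U *m (U *m e))) e.
  have df i y : differentiable (f i) y by have [[]] := hf i.
  have := rsc (x k.+1); rewrite frobenius_sqr !gradient_gfun // -/e.
  rewrite (_ : _ + _ - _ = D1 + D0 + (2 * alpha)^-1 *: (U *m (U *m e))) //.
  rewrite mulmxA UU /e mulmxBr scalerBr /D1 /D0 subrKA.
  by rewrite opprD addrACA.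
have desc := extra_descent symU symWt psdM al_gt0 rec rsc_e.
have lyap : mx_inner s s + mx_inner e (Wt *m e)
    <= C * (mx_inner e e + mx_inner d d).
  by rewrite sE in rec *; exact: lyap_le rec D0_le.
have young : 2 * alpha * mx_inner D1 e
    <= alpha * Lf ^+ 2 / eta * mx_inner d d + alpha * eta * mx_inner e e.
  have le1 : eta^-1 * mx_inner D1 D1 <= eta^-1 * (Lf ^+ 2 * mx_inner d d).
    by rewrite ler_pM2l ?invr_gt0.
  have le2 := le_trans (mx_inner_young D1 e eta_gt0) (lerD le1 (lexx _)).
  by have := ler_wpM2l (ltW al_gt0) le2; lra.
have Wd_ge : lam * mx_inner d d <= mx_inner d (Wt *m d) by exact: lambda_min_le.
rewrite qkE xkE -/e -/s.
set V' := mx_inner s s + _; set V := mx_inner (s - _) _ + _ in desc *.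
have E_ge0 := mx_inner_ge0 e; have D_ge0 := mx_inner_ge0 d.
have margin : V' + (a * mx_inner e e + b * mx_inner d d) <= V.
  by rewrite /a /b /V' in desc *; lra.
rewrite mulrDl mul1r (le_trans _ margin) // lerD2l -mulrA.
rewrite (@le_trans _ _ (c * (mx_inner e e + mx_inner d d))) //.
  by rewrite ler_pM2l // ler_pdivrMl.
by rewrite mulrDr lerD // ler_wpM2r // /c ge_min lexx ?orbT.
Qed.

End LinearConvergence.

Theorem theorem3p7 (R : realType) (n p : nat) (hn : (0 < n)%N) (hp : (0 < p)%N)
    (E : rel 'I_n) (W Wt : 'M[R]_n)
    (f : 'I_n -> 'rV[R]_p -> R) (L : 'I_n -> R)
    (hE : connected_graph E) (hW : mixing_matrices E W Wt)
    (hf : smooth_convex f L)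
    (hopt : exists x, is_minimizer (fbar f) x)
    (alpha : R) (halpha : 0 < alpha)
    (U : 'M[R]_n) (hU : psd_sqrt U (Wt - W))
    (xs : 'rV[R]_p) (hxs : is_minimizer (fbar f) xs)
    (qs : 'M[R]_(n, p)) (hqs : exists P : 'M[R]_(n, p), qs = U *m P)
    (hKKT : U *m qs + alpha *: grad_rows f (consensus n xs) = 0)
    (mu : R)
    (hg : restricted_strongly_convex (gfun f W Wt alpha) (consensus n xs) mu)
    (hstep : alpha < 2 * mu * lambda_min Wt
                     / (\big[Num.max/0]_(i < n) L i) ^+ 2) :
  let zs := col_mx qs (consensus n xs) in
  exists delta : R, 0 < delta /\
    forall x : nat -> 'M[R]_(n, p), extra f W Wt alpha x ->
      let ez := fun k => wnorm (Gmx Wt) (zseq U x k - zs) ^+ 2 in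
      let ex := fun k => wnorm Wt (x k - consensus n xs) ^+ 2 in
      [/\ forall k, ez k >= (1 + delta) * ez k.+1,
          ez @ \oo --> (0 : R) /\ r_linear ez delta &
          ex @ \oo --> (0 : R) /\ r_linear ex delta].
Proof.
move=> zs; have [_ _ [nullH nullI] [/pdmx_psd psdWt le_half _]] := hW.
have [[symU _] UU] := hU.
have psdM : psdmx (1%:M + W - 2 *: Wt).
  have -> : 1%:M + W - 2 *: Wt = 2 *: (2^-1 *: (1%:M + W) - Wt).
    by rewrite scalerBr scalerA divff ?scale1r ?pnatr_eq0.
  exact: psdmx_scale.
have ones_span : @span_ones R n (const_mx 1) by exists 1; rewrite scale1r.
have H1 : (W - Wt) *m const_mx 1 = 0 :> 'cV[R]_n.
  by have := ones_span; rewrite -nullH.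
have I1 : (1%:M - Wt) *m const_mx 1 = 0 :> 'cV[R]_n by exact: nullI ones_span.
have Mxs : (1%:M + W - 2 *: Wt) *m consensus n xs = 0.
  have -> : 1%:M + W - 2 *: Wt = (1%:M - Wt) + (W - Wt).
    by rewrite scaler_nat mulr2n opprD addrACA.
  by rewrite mulmxA mulmxDl I1 H1 addr0 mul0mx.
have Uxs : U *m consensus n xs = 0.
  apply/eqP; rewrite -mx_inner_eq0 mx_inner_adjoint symU mulmxA UU mulmxA.
  by rewrite -opprB mulNmx H1 oppr0 mul0mx /mx_inner trmx0 mul0mx mxtrace0.
have [delta delta_gt0 contr] := extra_contraction hn hf psdWt psdM hU halpha
  Mxs Uxs hqs hKKT hg hstep.
exists delta; split=> // x hx ez ex; have {}contr := contr x hx.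
have ez_lin : r_linear ez delta by exact: r_linear_of_contraction.
have ex_lin : r_linear ex delta.
  have [C ez_le] := ez_lin; exists C => k; apply: le_trans (ez_le k).
  rewrite /ex /ez /zseq /zs opp_col_mx add_col_mx wnorm_Gmx_sqr // wnorm_sqr //.
  by rewrite lerDr mx_inner_ge0.
by split=> //; split=> //; apply: r_linear_cvg0 delta_gt0 _ _ => // k;
   rewrite sqr_ge0.
Qed.
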